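(* Let $G$ be a compact metrizable group with normalized Haar measure $m$. (1) If $T:G\to G$ is a surjective continuous homomorphism, then $m\in M(T)$. (2) If $T:G\to G$ is a continuous homomorphism and $\mu,\nu\in M(T)$, then $\mu*\nu\in M(T)$.
   Context: For a continuous map $T:G\to G$, $M(T)$ denotes the set of all Borel probability measures $\mu$ on $G$ that are $T$-invariant, i.e. $\mu(T^{-1}E)=\mu(E)$ for all Borel $E\subseteq G$. For Borel probability measures $\mu,\nu$ on $G$, the convolution $\mu*\nu$ is defined by $\mu*\nu(E)=(\mu\times\nu)(\pi^{-1}(E))$ for Borel $E$, where $\pi:G\times G\to G$, $\pi(x,y)=xy$. *)

(* Defs.v *)
From HB Require Import structures.
From mathcomp Require Import all_boot all_order all_algebra.
From mathcomp Require Import finmap.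
From mathcomp Require Import all_classical all_reals all_analysis.

Set Implicit Arguments.
Unset Strict Implicit.
Unset Printing Implicit Defensive.

Import Order.TTheory GRing.Theory Num.Theory.

Local Open Scope classical_set_scope.
Local Open Scope ring_scope.

(* The distinguished point of a ptopologicalType is arbitrary and plays no     *)
(* role: it is there because measurable types are pointed.                     *)
HB.mixin Record isTopologicalGroup G & Group G & PointedTopological G := {
  mulg_continuous : continuous (fun p : G * G => (p.1 * p.2)%g) ;
  invg_continuous : continuous (fun x : G => (x^-1)%g)
}.

#[short(type="topologicalGroupType")]
HB.structure Definition TopologicalGroup :=
  {G of Group G & PointedTopological G & isTopologicalGroup G}.

Definition metrizable (R : realType) (T : topologicalType) : Prop :=
  exists d : T -> T -> R,
    [/\ forall x y, d x y = 0 <-> x = y,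
        forall x y, d x y = d y x,
        forall x y z, d x z <= d x y + d y z
      & forall A : set T,
          open A <-> forall x, A x ->
            exists2 e : R, 0 < e & [set y | d x y < e] `<=` A].

HB.mixin Record isCompactMetrizable (R : realType) G & PointedTopological G := {
  compact_setT_subproof : compact [set: G] ;
  metrizable_subproof : metrizable R G
}.

#[short(type="compactMetrizableGroupType")]
HB.structure Definition CompactMetrizableGroup (R : realType) :=
  {G of TopologicalGroup G & isCompactMetrizable R G}.

Notation borelType T := (g_sigma_algebraType (@open T)).

Section metrizable_theory.
Context {R : realType} {T : ptopologicalType}.

Lemma compact_metrizable_second_countable :
  compact [set: T] -> metrizable R T -> @second_countable T.
Proof.
move=> cT [d [d0 dC dD dO]].
have dxx x : d x x = 0 by apply/d0.
have oB x e : open [set y | d x y < e].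
  apply/dO => y /= xy; exists (e - d x y); first by rewrite subr_gt0.
  by move=> z /=; rewrite ltrBrDl; apply: le_lt_trans.
pose f n (x : T) : set T := [set y | d x y < n.+1%:R^-1].
have h n : finite_subset_cover [set: T] (f n) [set: T].
  move: cT; rewrite compact_cover => /(_ T setT (f n)); apply.
  - by move=> x _; exact: oB.
  - by move=> x _; exists x => //=; rewrite /f /= dxx.
have {h} /choice[D hD] n :
    exists D : set T, finite_set D /\ [set: T] `<=` cover D (f n).
  by have [D _ hD] := h n; exists [set` D]; split.
exists (\bigcup_n (f n) @` D n).
  apply: bigcup_countable => // n _; apply: finite_set_countable.
  by apply: finite_image; have [] := hD n.
split; first by move=> _ [n _ [x _ <-]]; exact: oB.
move=> x V; rewrite nbhsE => -[U [oU Ux] UV].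
have [e e0 eU] := (dO U).1 oU x Ux.
have [|n] := @ltr_add_invr R 0%R (e / 2) _; first by rewrite divr_gt0.
rewrite add0r => ne.
have [_ /(_ x I)[w wD wx]] := hD n.
exists (f n w); first by split => //; exists n => //; exists w.
move=> z /= wz; apply/UV/eU => /=.
apply: le_lt_trans (dD x w z) _.
by rewrite [e]splitr ltrD ?(dC x w) ?(lt_trans wx)// (lt_trans wz).
Qed.

End metrizable_theory.

Section borel_theory.
Context {T : ptopologicalType}.

Lemma open_borel (A : set T) : open A -> measurable (A : set (borelType T)).
Proof. exact: sub_sigma_algebra. Qed.

Lemma open_borel_prod (A : set (T * T)) : @second_countable T -> open A ->
  measurable (A : set (borelType T * borelType T)).
Proof.
move=> [B cB [oB bB]] oA.
pose P := [set b : set T * set T | [/\ B b.1, B b.2 & b.1 `*` b.2 `<=` A]].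
have -> : A = \bigcup_(b in P) (b.1 `*` b.2).
  apply/seteqP; split => [[x y] Axy|p [b [_ _]]]; last exact.
  have : nbhs (x, y) A by exact: open_nbhs_nbhs.
  move=> [[U V] /= [xU yV] UVA].
  have [U' [BU' U'x] U'U] := bB x U xU.
  have [V' [BV' V'y] V'V] := bB y V yV.
  exists (U', V') => //=; split => //= -[u v] /= [U'u V'v].
  by apply: UVA; split; [exact: U'U|exact: V'V].
have cP : countable P.
  apply: (sub_countable _ (countableX cB cB)).
  by apply: subset_card_le => b [].
rewrite bigcup_set_type; apply: countable_bigcupT_measurable => [|[b /= Pb]].
  by rewrite (eq_countable (card_setT P)).
have [/oB oB1 /oB oB2 _] := set_mem Pb.
by apply: measurableX; exact: open_borel.
Qed.

End borel_theory.

Section group_borel.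
Context {R : realType} {G : compactMetrizableGroupType R}.

Lemma measurable_mulg : measurable_fun [set: borelType G * borelType G]
  (fun p : G * G => (p.1 * p.2)%g : borelType G).
Proof.
apply: (@measurability _ _ (borelType G * borelType G)%type (borelType G)
  setT _ (@open G)) => //.
move=> _ [A oA <-]; rewrite setTI; apply: open_borel_prod.
  apply: compact_metrizable_second_countable.
    exact: (@compact_setT_subproof R).
  exact: metrizable_subproof.
by move/continuousP : (@mulg_continuous G); apply.
Qed.

End group_borel.

Definition convolution (R : realType) (G : compactMetrizableGroupType R)
    (mu nu : probability (borelType G) R) : set (borelType G) -> \bar R :=
  pushforward (mu \x nu)%E (fun p : G * G => (p.1 * p.2)%g : borelType G).

Section convolution_probability.
Context {R : realType} {G : compactMetrizableGroupType R}.
Variables mu nu : probability (borelType G) R.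
Local Open Scope ereal_scope.

Let convolution0 : convolution mu nu set0 = 0.
Proof. by apply: measure0 => //; exact: measurable_mulg. Qed.

Let convolution_ge0 A : 0 <= convolution mu nu A.
Proof. by apply: measure_ge0 => //; exact: measurable_mulg. Qed.

Let convolution_sigma_additive : semi_sigma_additive (convolution mu nu).
Proof. by apply: measure_semi_sigma_additive => //; exact: measurable_mulg. Qed.

HB.instance Definition _ := isMeasure.Build _ _ _ (convolution mu nu)
  convolution0 convolution_ge0 convolution_sigma_additive.

Let convolution_setT : convolution mu nu setT = 1.
Proof.
rewrite /convolution /pushforward preimage_setT -setXTT product_measure1E//.
rewrite -[RHS]mule1; congr (_ * _); exact: probability_setT.
Qed.

HB.instance Definition _ := Measure_isProbability.Build _ _ _
  (convolution mu nu) convolution_setT.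

End convolution_probability.

Definition invariant_probabilities (R : realType) (T : ptopologicalType)
    (f : T -> T) : set (probability (borelType T) R) :=
  [set mu | forall E : set (borelType T), measurable E ->
              mu (f @^-1` E) = mu E].

(* Regularity is not required: every finite Borel measure on a compact         *)
(* metrizable space is regular. Right invariance follows from left invariance, *)
(* since a compact group is unimodular.                                        *)
Definition normalized_haar (R : realType) (G : compactMetrizableGroupType R)
    (m : probability (borelType G) R) : Prop :=
  forall (x : G) (E : set (borelType G)), measurable E ->
    m [set (x * y)%g | y in E] = m E.

(* Main.v *)
(* Everything in (1) comes from evaluating, by Tonelli, the product measure of
   [{(x, y) | x^-1 T(y) \in E}] in two ways.  When [T] is surjective, writing
   [x = T g] shows that the section at [x] is [g T^-1(E)], of measure
   [m (T^-1 E)]; the section at [y] is [T(y) E^-1], of measure [m (E^-1)].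
   Hence [m (T^-1 E) = m (E^-1)] for every surjective [T], in particular for
   the identity, so that [m (T^-1 E) = m E]: neither uniqueness of Haar measure
   nor unimodularity is needed.  For (2), [T o pi = pi o (T x T)], and [T x T]
   preserves [mu x nu]. *)
Require Import Defs.
From mathcomp Require Import all_boot all_order all_algebra.
From mathcomp Require Import all_classical all_reals all_analysis.

Local Open Scope classical_set_scope.

Lemma continuous_borel_measurable {S T : ptopologicalType} {f : S -> T} :
  continuous f ->
  measurable_fun [set: borelType S] (f : borelType S -> borelType T).
Proof.
move=> /continuousP cf.
apply: (@measurability _ _ (borelType S) (borelType T) setT _ (@open T)) => //.
by move=> _ [A oA <-]; rewrite setTI; apply: open_borel; exact: cf.
Qed.

Section product_measure.
Context {d1 d2} {T1 : measurableType d1} {T2 : measurableType d2}.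
Context {R : realType}.
Local Open Scope ring_scope.
Local Open Scope ereal_scope.

(** Tonelli for the indicator of [A]: integrating out one variable leaves the measure of a
    section. *)
Lemma product_measure_sections
    (mu : {sigma_finite_measure set T1 -> \bar R})
    (nu : {sigma_finite_measure set T2 -> \bar R}) {A : set (T1 * T2)} :
  measurable A ->
  \int[mu]_x nu (xsection A x) = \int[nu]_y mu (ysection A y).
Proof.
move=> mA; have := indic_fubini_tonelli mu nu mA.
by rewrite indic_fubini_tonelli_FE// indic_fubini_tonelli_GE.
Qed.

(** The pushforward of [mu \x nu] under [f] times [g] agrees with [mu \x nu] on measurable
    rectangles, and for sigma-finite factors this determines the product measure. *)
Lemma product_measure_preserving
    (mu : {sigma_finite_measure set T1 -> \bar R})
    (nu : {sigma_finite_measure set T2 -> \bar R})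
    {f : T1 -> T1} {g : T2 -> T2} :
  measurable_fun setT f -> measurable_fun setT g ->
  (forall A, measurable A -> mu (f @^-1` A) = mu A) ->
  (forall B, measurable B -> nu (g @^-1` B) = nu B) ->
  forall X, measurable X ->
    (mu \x nu) ((fun p => (f p.1, g p.2)) @^-1` X) = (mu \x nu) X.
Proof.
move=> mf mg fmu gnu X mX.
have mfg : measurable_fun [set: T1 * T2] (fun p => (f p.1, g p.2)).
  by apply: measurable_fun_pair; apply: measurableT_comp.
rewrite -[LHS]/(pushforward (mu \x nu) _ X).
apply/esym/product_measure_unique => // A B mA mB; rewrite /pushforward/=.
rewrite -[LHS]/((mu \x nu) ((f @^-1` A) `*` (g @^-1` B))).
rewrite product_measure1E.
- by congr (_ * _); [exact: fmu|exact: gnu].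
- by rewrite -[f @^-1` A]setTI; exact: mf.
- by rewrite -[g @^-1` B]setTI; exact: mg.
Qed.

End product_measure.

Section haar.
Context {R : realType} {G : compactMetrizableGroupType R}.

Lemma haar_preimage_surj_morphism (m : probability (borelType G) R)
    (T : G -> G) (E : set (borelType G)) :
  normalized_haar m -> continuous T -> {morph T : x y / (x * y)%g} ->
  set_surj setT setT T -> measurable E ->
  m (T @^-1` E) = m [set x | E (x^-1)%g].
Proof.
move=> hm cT TM Tsurj mE.
have mpre (f : borelType G -> borelType G) B :
    measurable_fun setT f -> measurable B -> measurable (f @^-1` B).
  by move=> mf mB; rewrite -[X in measurable X]setTI; exact: mf.
have mT := continuous_borel_measurable cT.
have mV := continuous_borel_measurable (@invg_continuous G).
pose S : set (borelType G * borelType G) :=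
  [set p | E (p.1^-1 * T p.2)%g].
have mS : measurable S.
  have mVT : measurable_fun [set: borelType G * borelType G]
      (fun p => ((p.1^-1)%g : borelType G, T p.2 : borelType G)).
    by apply: measurable_fun_pair; apply: measurableT_comp.
  by rewrite -[S]setTI; exact: (measurableT_comp measurable_mulg mVT).
have Sx x : m (xsection S x) = m (T @^-1` E).
  have [g _ gx] := Tsurj x I.
  rewrite -(hm g (T @^-1` E)); last exact: (mpre _ _ mT mE).
  congr (m _); apply/seteqP; split => [y /xsectionP|y [z /= Ez <-]].
    rewrite /S/= -gx => Ey; exists (g^-1 * y)%g; last exact: mulVKg.
    (* Compatibility of [T] with inverses is obtained from multiplicativity, by cancelling [T g] on
       the left. *)
    suff -> : T (g^-1 * y)%g = ((T g)^-1 * T y)%g by [].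
    by apply: (@mulgI _ (T g)); rewrite -TM mulVKg mulVKg.
  by apply/xsectionP; rewrite /S/= -gx TM mulKg.
have Sy y : m (ysection S y) = m [set x | E (x^-1)%g].
  rewrite -(hm (T y) [set x | E (x^-1)%g]); last exact: (mpre _ _ mV mE).
  congr (m _); apply/seteqP; split => [x /ysectionP|x [z /= Ez <-]].
    (* The inverse of this witness is [x^-1 * T y], which lies in [E] because [(x, y)] lies in
       [S]. *)
    move=> Ex; exists ((T y)^-1 * x)%g; last exact: mulVKg.
    by rewrite /= invgM invgK.
  by apply/ysectionP; rewrite /S/= invgM mulgVK.
have := product_measure_sections m m mS.
rewrite (eq_integral (cst (m (T @^-1` E)))); last by move=> x _; exact: Sx.
rewrite [RHS](eq_integral (cst (m [set x | E (x^-1)%g])));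
  last by move=> y _; exact: Sy.
(* A constant integrates to itself since [m] has total mass 1. *)
have int_cst c : (\int[m]_x cst c x = c)%E.
  rewrite integral_cst// -[RHS]mule1.
  by congr (_ * _)%E; exact: probability_setT.
by rewrite !int_cst.
Qed.

Lemma haar_invariant (m : probability (borelType G) R) (T : G -> G) :
  normalized_haar m -> continuous T -> {morph T : x y / (x * y)%g} ->
  set_surj setT setT T -> invariant_probabilities T m.
Proof.
move=> hm cT TM Tsurj E mE.
rewrite haar_preimage_surj_morphism//.
(* The measure of the inverse of [E] is independent of [T]; the identity turns it into [m E]. *)
rewrite -(@haar_preimage_surj_morphism m idfun)//.
by move=> x; exact: cvg_id.
Qed.

Lemma convolution_invariant (T : G -> G) (mu nu : probability (borelType G) R) :
  continuous T -> {morph T : x y / (x * y)%g} ->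
  invariant_probabilities T mu -> invariant_probabilities T nu ->
  invariant_probabilities T (convolution mu nu).
Proof.
move=> cT TM muT nuT E mE.
have mT := continuous_borel_measurable cT.
pose mul (p : borelType G * borelType G) : borelType G := (p.1 * p.2)%g.
have mmulE : measurable (mul @^-1` E).
  by rewrite -[mul @^-1` E]setTI; exact: measurable_mulg.
rewrite -[RHS](product_measure_preserving mu nu mT mT muT nuT _ mmulE).
by congr ((mu \x nu)%E _); apply/funext => -[x y] /=; rewrite TM.
Qed.

End haar.

Theorem theorem2p2 (R : realType) (G : compactMetrizableGroupType R) :
  (forall m : probability (borelType G) R, normalized_haar m ->
     forall T : G -> G,
       continuous T -> {morph T : x y / (x * y)%g} -> set_surj setT setT T ->
       invariant_probabilities T m)
  /\
  (forall T : G -> G,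
     continuous T -> {morph T : x y / (x * y)%g} ->
     forall mu nu : probability (borelType G) R,
       invariant_probabilities T mu -> invariant_probabilities T nu ->
       invariant_probabilities T (convolution mu nu)).
Proof.
split=> [m hm T cT TM Tsurj|T cT TM mu nu]; first exact: haar_invariant.
exact: convolution_invariant.
Qed.
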